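(* Let $\mathcal{P}$ be a collection of probability distributions on $\mathcal{Z}^{n+1}$. A fuzzy prediction set $\mathcal{E}^{Z^n}:\mathcal{Z}\to[0,\infty]$ for $Z_{n+1}$, i.e. a jointly measurable family $(\mathcal{E}^{z^n})_{z^n\in\mathcal{Z}^n}$ of maps $\mathcal{Z}\to[0,\infty]$, is equivalent to a fuzzy prediction set $\mathcal{E}:\mathcal{Z}^{n+1}\to[0,\infty]$ for $Z^{n+1}$, through the one-to-one correspondence $\mathcal{E}^{z^n}(z)=\mathcal{E}(z^n,z)$. Such a fuzzy prediction set $\mathcal{E}$ is an e-value, and it is valid for the model $\mathcal{P}$ if and only if it is a valid e-value for the hypothesis $\mathcal{P}$.
   Context: $\mathcal{Z}$ is a measurable sample space and $Z^{n+1}=(Z^n,Z_{n+1})$ denotes a random element of $\mathcal{Z}^{n+1}$. A fuzzy prediction set for $Z_{n+1}$ is valid for $\mathcal{P}$ if $\mathrm{E}^P[\mathcal{E}^{Z^n}(Z_{n+1})]\le1$ for every $P\in\mathcal{P}$. An e-value is a measurable map $\mathcal{E}:\mathcal{Z}^{n+1}\to[0,\infty]$; it is a valid e-value for the hypothesis $\mathcal{P}$ if $\mathrm{E}^P[\mathcal{E}(Z^{n+1})]\le1$ for every $P\in\mathcal{P}$. *)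

(* Defs.v *)
From mathcomp Require Import all_boot all_order all_algebra.
From mathcomp Require Import all_classical all_reals all_analysis.
From mathcomp Require Import measurable_realfun.
Set Implicit Arguments.
Unset Strict Implicit.
Unset Printing Implicit Defensive.
Import Order.TTheory GRing.Theory Num.Theory.
Local Open Scope classical_set_scope.
Local Open Scope ereal_scope.

(* [0, +oo]-valued measurable maps, as maps into \bar R (Borel sigma-algebra). *)
Definition nonneg_measurable d (T : measurableType d) (R : realType)
    (f : T -> \bar R) : Prop :=
  (forall x, 0 <= f x) /\ measurable_fun [set: T] f.

Section FuzzyPredictionSets.
Context d (Z : measurableType d) (R : realType) (n : nat).

Implicit Types (F : n.-tuple Z -> Z -> \bar R) (E : n.+1.-tuple Z -> \bar R).
Implicit Types PP : set (probability (n.+1.-tuple Z) R).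

(* The two components of Z^{n+1} = (Z^n, Z_{n+1}). *)
Definition past (x : n.+1.-tuple Z) : n.-tuple Z :=
  [tuple tnth x (widen_ord (leqnSn n) i) | i < n].
Definition next (x : n.+1.-tuple Z) : Z := tnth x ord_max.

(* A family (F zn)_zn of maps Z -> [0, +oo]; joint measurability is with respect
   to the product sigma-algebra on Z^n x Z. *)
Definition fuzzy_prediction_set_next F : Prop :=
  nonneg_measurable (fun p : n.-tuple Z * Z => F p.1 p.2).

(* A fuzzy prediction set for the whole vector Z^{n+1} is based on no data, so
   the family reduces to a single map. *)
Definition fuzzy_prediction_set_joint E : Prop := nonneg_measurable E.

Definition e_value E : Prop := nonneg_measurable E.

Definition sections E : n.-tuple Z -> Z -> \bar R :=
  fun zn z => E [tuple of rcons zn z].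

(* Expectations are taken on the canonical space: under P, Z^{n+1} is the
   identity on Z^{n+1}. *)
Definition valid_fuzzy_prediction_set PP F : Prop :=
  fuzzy_prediction_set_next F /\
  forall P, PP P -> \int[P]_x F (past x) (next x) <= 1.

Definition valid_e_value PP E : Prop :=
  e_value E /\ forall P, PP P -> \int[P]_x E x <= 1.

End FuzzyPredictionSets.

(* Main.v *)
(* Splitting off the last coordinate is a bimeasurable bijection between
   Z^{n+1} and Z^n x Z, with inverse rcons; everything follows by composing
   with it in either direction. *)
Require Import Defs.
From mathcomp Require Import all_boot all_order all_algebra.
From mathcomp Require Import all_classical all_reals all_analysis.
From mathcomp Require Import measurable_realfun.
Local Open Scope classical_set_scope.
Local Open Scope ereal_scope.

(** Appending the last coordinate and splitting it off are mutually inverse ([rcons_past_next],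
    [past_rcons], [next_rcons]), and both are measurable. Since [sections] is precomposition with
    appending, it is a bijection that preserves measurability and nonnegativity in both directions
    ([fuzzy_prediction_set_sections]). Validity is then the same inequality on both sides, because
    the two integrands agree at every point. *)

Lemma rcons_past_next d (Z : measurableType d) n (x : n.+1.-tuple Z) :
  [tuple of rcons (past x) (Defs.next x)] = x.
Proof.
apply: eq_from_tnth => i.
rewrite (tnth_nth (Defs.next x)) /= nth_rcons size_tuple card_ord.
have := ltn_ord i; rewrite ltnS leq_eqVlt => /orP[/eqP eq_in|lt_in].
  by rewrite eq_in ltnn eqxx; congr (tnth x _); exact: val_inj.
(* The index is recast as an element of ['I_n], so that [nth] folds back into [tnth] of [past x]. *)
rewrite lt_in -[nat_of_ord i]/(nat_of_ord (Ordinal lt_in)).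
rewrite -(tnth_nth _ (past x)).
by rewrite tnth_mktuple; congr (tnth x _); exact: val_inj.
Qed.

Lemma past_rcons d (Z : measurableType d) n (zn : n.-tuple Z) (z : Z) :
  past [tuple of rcons zn z] = zn.
Proof.
apply: eq_from_tnth => i.
by rewrite tnth_mktuple !(tnth_nth z) /= nth_rcons size_tuple ltn_ord.
Qed.

Lemma next_rcons d (Z : measurableType d) n (zn : n.-tuple Z) (z : Z) :
  Defs.next [tuple of rcons zn z] = z.
Proof. by rewrite /Defs.next (tnth_nth z) /= nth_rcons size_tuple ltnn eqxx. Qed.

Lemma measurable_past d (Z : measurableType d) n :
  measurable_fun [set: n.+1.-tuple Z] (@past d Z n).
Proof.
apply/measurable_fun_tnthP => i.
rewrite (_ : _ \o _ = (@tnth _ Z)^~ (widen_ord (leqnSn n) i)).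
  exact: measurable_tnth.
by apply/funext => x /=; rewrite tnth_mktuple.
Qed.

(** Measurability into tuples is checked coordinatewise, and each coordinate here is a projection:
    [snd] at the last index, a coordinate of [fst] before it. *)
Lemma measurable_rcons d (Z : measurableType d) n :
  measurable_fun [set: n.-tuple Z * Z]
    (fun p => [tuple of rcons p.1 p.2] : n.+1.-tuple Z).
Proof.
apply/measurable_fun_tnthP => i.
have := ltn_ord i; rewrite ltnS leq_eqVlt => /orP[/eqP eq_in|lt_in].
  rewrite (_ : _ \o _ = snd); first exact: measurable_snd.
  apply/funext => p /=.
  by rewrite (tnth_nth p.2) /= nth_rcons size_tuple eq_in ltnn eqxx.
rewrite (_ : _ \o _ = (@tnth _ Z)^~ (Ordinal lt_in) \o fst).
  by apply: measurableT_comp; [exact: measurable_tnth|exact: measurable_fst].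
by apply/funext => p /=; rewrite !(tnth_nth p.2) /= nth_rcons size_tuple lt_in.
Qed.

Lemma sections_past_next d (Z : measurableType d) (R : realType) n
    (E : n.+1.-tuple Z -> \bar R) x :
  sections E (past x) (Defs.next x) = E x.
Proof. by rewrite /sections rcons_past_next. Qed.

Lemma fuzzy_prediction_set_sections d (Z : measurableType d) (R : realType) n
    (E : n.+1.-tuple Z -> \bar R) :
  fuzzy_prediction_set_next (sections E) <-> nonneg_measurable E.
Proof.
split=> -[E0 mE]; split.
- by move=> x; rewrite -sections_past_next; exact: (E0 (past x, Defs.next x)).
(* [E] is recovered from its sections by precomposing with the measurable splitting map. *)
- rewrite (_ : E = (fun p => sections E p.1 p.2) \o
                   (fun x => (past x, Defs.next x))).
    apply: measurableT_comp => //; apply: measurable_fun_pair.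
      exact: measurable_past.
    exact: measurable_tnth.
  by apply/funext => x /=; rewrite sections_past_next.
- by move=> p; exact: E0.
- by apply: (measurableT_comp mE); exact: measurable_rcons.
Qed.

Theorem theorem4 (d : measure_display) (Z : measurableType d) (R : realType)
    (n : nat) (PP : set (probability (n.+1.-tuple Z) R)) :
  set_bij [set E | @fuzzy_prediction_set_joint d Z R n E]
          [set F | @fuzzy_prediction_set_next d Z R n F]
          (@sections d Z R n) /\
  (forall (F : n.-tuple Z -> Z -> \bar R) (E : n.+1.-tuple Z -> \bar R),
    fuzzy_prediction_set_next F ->
    (forall (zn : n.-tuple Z) (z : Z), F zn z = E [tuple of rcons zn z]) ->
    e_value E /\
    (valid_fuzzy_prediction_set PP F <-> valid_e_value PP E)).
Proof.
split.
  split.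
  - by move=> E /= /fuzzy_prediction_set_sections.
  - move=> E1 E2 _ _ eqE; apply/funext => x.
    by rewrite -(sections_past_next _ _ _ _ E1) eqE sections_past_next.
  (* Surjectivity: the preimage of [F] evaluates it on the split vector. *)
  - move=> F /= fF.
    have secF : sections (fun x => F (past x) (Defs.next x)) = F.
      apply/funext => zn; apply/funext => z.
      by rewrite /sections past_rcons next_rcons.
    exists (fun x => F (past x) (Defs.next x)) => //=.
    by apply/fuzzy_prediction_set_sections; rewrite secF.
move=> F E fF FE.
have {FE} eqF : F = sections E by apply/funext => zn; apply/funext => z.
rewrite {}eqF in fF *.
have eE : e_value E by exact/fuzzy_prediction_set_sections.
(* The integrands coincide everywhere, so the expectations agree under every [P], whether or not it
   lies in [PP]. *)
have eqI (P : probability (n.+1.-tuple Z) R) :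
    \int[P]_x sections E (past x) (Defs.next x) = \int[P]_x E x.
  by apply: eq_integral => x _; rewrite sections_past_next.
by split=> //; split=> -[_ vE]; split=> // P /vE; rewrite eqI.
Qed.
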